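(* Let $m\ge2$ and $n\ge1$ be integers. Let $X_1,X_2,\dots$ and $Y_1,Y_2,\dots$ be independent random variables (all mutually independent), with each $X_i$ uniformly distributed on $\{1,\dots,m\}$ and each $Y_i$ uniformly distributed on $[0,1]$. Define \[ U_{n,m}=\sum_{i,j=1}^n\mathbf{1}\{X_i>X_j\}\,\mathbf{1}\{Y_i<Y_j\}. \] Then $U_{n,m}$ has probability generating function $m^{-n}G_n^{(m)}(q)$, i.e. $U_{n,m}$ has the same distribution as $G_{n,m}$.
   Context: With $[\ell]_q=(1-q^\ell)/(1-q)$, $[k]!_q=[1]_q\cdots[k]_q$, $[0]!_q=1$ and $\binom{n}{k_1,\dots,k_m}_q=\frac{[n]!_q}{[k_1]!_q\cdots[k_m]!_q}$ for nonnegative $k_1+\dots+k_m=n$, the generalized Galois number is $G_n^{(m)}(q)=\sum_{k_1+\dots+k_m=n}\binom{n}{k_1,\dots,k_m}_q$; $G_{n,m}$ denotes a random variable with probability generating function $m^{-n}G_n^{(m)}(q)$. $\mathbf{1}\{\cdot\}$ denotes an indicator. *)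

(* Defs.v *)
From HB Require Import structures.
From mathcomp Require Import all_boot all_order all_algebra finmap.
From mathcomp Require Import all_classical all_reals all_analysis measurable_realfun.
Set Implicit Arguments.
Unset Strict Implicit.
Unset Printing Implicit Defensive.
Import Order.TTheory GRing.Theory Num.Theory.
Import numFieldNormedType.Exports.
Local Open Scope classical_set_scope.
Local Open Scope ring_scope.

(* The parameter q is the indeterminate 'X of {poly F}, so that generalized
   Galois numbers are polynomials in q and can be evaluated everywhere, roots
   of unity included.  The two quotients below are polynomial divisions; they
   are exact by qintE and qmultinomE. *)
Section QAnalogues.
Variable F : fieldType.

Definition qint (l : nat) : {poly F} := (1 - 'X^l) %/ (1 - 'X).

Definition qfact (k : nat) : {poly F} := \prod_(1 <= l < k.+1) qint l.

Definition qmultinom (n m : nat) (k : 'I_m -> nat) : {poly F} :=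
  qfact n %/ \prod_(i < m) qfact (k i).

(* Each part is at most n, so ranging over 'I_n.+1 loses no composition. *)
Definition galois (n m : nat) : {poly F} :=
  \sum_(k : {ffun 'I_m -> 'I_n.+1} | (\sum_(i < m) k i)%N == n)
    qmultinom n (fun i => k i).

Lemma subr1X_neq0 : 1 - 'X != 0 :> {poly F}.
Proof. by rewrite -opprB oppr_eq0 polyXsubC_eq0. Qed.

Lemma qint_sum l : qint l = \sum_(i < l) 'X^i.
Proof.
rewrite /qint; have -> : 1 - 'X^l = (\sum_(i < l) 'X^i) * (1 - 'X) :> {poly F}.
  by rewrite -opprB subrX1 mulrC -mulrN opprB.
by rewrite mulpK // subr1X_neq0.
Qed.

Lemma qintE l : qint l * (1 - 'X) = 1 - 'X^l.
Proof. by rewrite qint_sum -[RHS]opprB subrX1 mulrC -mulNr opprB. Qed.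

Lemma qfactS k : qfact k.+1 = qfact k * qint k.+1.
Proof. by rewrite /qfact big_nat_recr. Qed.

Lemma qfact_neq0 k : qfact k != 0.
Proof.
elim: k => [|k IH]; first by rewrite /qfact big_geq ?oner_neq0.
rewrite qfactS mulf_neq0 //; apply/eqP => q0.
have := congr1 (coefp 0) (qintE k.+1).
by rewrite q0 mul0r /= coefB coef0 coef1 coefXn subr0 => /esym/eqP; rewrite oner_eq0.
Qed.

Lemma qfact_dvdD a b : qfact a * qfact b %| qfact (a + b).
Proof.
move Dn: (a + b)%N => n; elim: n a b Dn => [|n IH] [|a] [|b] //.
- by move=> _; rewrite /qfact !big_geq // mulr1.
- by rewrite add0n => -[->]; rewrite {1}/qfact big_geq // mul1r dvdpp.
- by rewrite addn0 => -[->]; rewrite {2}/qfact big_geq // mulr1 dvdpp.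
move=> [Dn]; rewrite (qfactS n).
have -> : qint n.+1 = qint a.+1 + 'X^(a.+1) * qint b.+1.
  apply: (mulIf subr1X_neq0); rewrite mulrDl -mulrA !qintE mulrBr mulr1.
  by rewrite -exprD addrA subrK -Dn addSn.
rewrite mulrDr dvdp_add //.
  by rewrite (qfactS a) mulrAC dvdp_mul // IH.
by rewrite (qfactS b) mulrA mulrCA dvdp_mull // dvdp_mul // IH // addSn -addnS.
Qed.

Lemma qmultinomE n m (k : 'I_m -> nat) : (\sum_(i < m) k i)%N = n ->
  qmultinom n k * \prod_(i < m) qfact (k i) = qfact n.
Proof.
move=> <-; rewrite /qmultinom divpK //.
elim/big_ind2: _ => [|x1 x2 y1 y2 h1 h2|//].
  by rewrite /qfact big_geq.
by apply: dvdp_trans (qfact_dvdD _ _); apply: dvdp_mul.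
Qed.

End QAnalogues.
Arguments galois F n m : clear implicits.

Section Probability.
Context d (T : measurableType d) (R : realType) (P : probability T R).

(* Mutual independence of a family of systems of events. *)
Definition mutually_independent (I : choiceType) (E : I -> set_system T) :=
  forall (J : {fset I}) (A : I -> set T), (forall i, i \in J -> E i (A i)) ->
  P (\bigcap_(i in [set` J]) A i) = (\prod_(i <- J) P (A i))%E.

Definition events_of d' (T' : measurableType d') (Z : {RV P >-> T'}) :
    set_system T :=
  preimage_set_system [set: T] Z measurable.

(* Independence of one countable family made of all the X i and all the Y i. *)
Definition independent_sequences d1 (T1 : measurableType d1)
    d2 (T2 : measurableType d2)
    (X : nat -> {RV P >-> T1}) (Y : nat -> {RV P >-> T2}) :=
  mutually_independent (fun i : nat + nat =>
    match i with inl i => events_of (X i) | inr j => events_of (Y j) end).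

Definition uniform_on_1_to (m : nat) (Z : {RV P >-> nat}) :=
  forall k : nat,
  distribution P Z [set k] = (if (1 <= k <= m)%N then m%:R^-1 else 0)%:E.

Definition uniform_on_01 (Z : {RV P >-> R}) :=
  forall B : set R, measurable B ->
  distribution P Z B = uniform_prob (@ltr01 R) B.

(* The generating function of Z is polynomial, equal to p. *)
Definition has_pgf (Z : {RV P >-> nat}) (p : {poly R}) :=
  forall q : R, `|q| <= 1 -> 'E_P[(fun w => q ^+ Z w)%R]%E = p.[q]%:E.

(* The sequences X_1, X_2, ... and Y_1, Y_2, ... are indexed from 0 here. *)
Definition U (n : nat) (X : nat -> {RV P >-> nat}) (Y : nat -> {RV P >-> R})
    (w : T) : nat :=
  (\sum_(i < n) \sum_(j < n) (X i w > X j w) * (Y i w < Y j w)%R)%N.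

Lemma measurable_sumn n (f : nat -> T -> nat) :
  (forall i, measurable_fun setT (f i)) ->
  measurable_fun setT (fun w => (\sum_(i < n) f i w)%N).
Proof.
move=> mf; elim: n => [|n IH].
  by under eq_fun do rewrite big_ord0; exact: measurable_cst.
by under eq_fun do rewrite big_ord_recr /=; exact: measurable_fun_addn.
Qed.

Lemma measurable_U n X Y : measurable_fun setT (U n X Y).
Proof.
have mb (b : T -> bool) : measurable_fun setT b ->
    measurable_fun setT (fun w => b w : nat).
  by move=> mb; apply: (@measurableT_comp _ _ _ _ _ _ nat_of_bool).
apply: (@measurable_sumn n
  (fun i w => \sum_(j < n) (X i w > X j w) * (Y i w < Y j w)%R)%N) => i.
apply: (@measurable_sumn n
  (fun j w => (X i w > X j w) * (Y i w < Y j w)%R)%N) => j.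
under eq_fun do rewrite mulnb.
apply/mb/measurable_and; first exact: measurable_fun_ltn.
exact: measurable_fun_ltr.
Qed.

HB.instance Definition _ n X Y :=
  isMeasurableFun.Build _ _ _ _ (U n X Y) (measurable_U n X Y).

End Probability.
Arguments U {d T R} P n X Y.

(* Main.v *)
(* Reading the letters X_i in increasing order of the Y_i, U counts the
   inversions of a word with independent uniform letters, so its generating
   function is m^-n times the sum of q^inv over all words, which MacMahon's
   recursion on the first letter identifies with the Galois number.
   Independence is only given for product events.  So the Y_i are localised in
   the cells of a grid of mesh 1/N: on an atom with pairwise distinct cells U is
   constant, whence P(U = s) >= (N^_n / N^n) p_s, with p_s the proportion of
   words having s inversions.  Let N tend to infinity; as both P(U = s) and p_s
   sum to 1, these inequalities are equalities.  Finally a polynomial probability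
   generating function determines its coefficients from its germ at 0+. *)
Require Import Defs.
From HB Require Import structures.
From mathcomp Require Import all_boot all_order all_algebra fingroup perm finmap.
From mathcomp Require Import zify lra.
From mathcomp Require Import all_classical all_reals all_analysis measurable_realfun.
Import Order.TTheory GRing.Theory Num.Theory.
Import numFieldNormedType.Exports.
Local Open Scope classical_set_scope.
Local Open Scope ring_scope.

(** * Inversions of words, q-multinomial coefficients and Galois numbers *)

Lemma big_tuple_cons (V : nmodType) (A : finType) n (F : n.+1.-tuple A -> V) :
  \sum_w F w = \sum_a \sum_(t : n.-tuple A) F [tuple of a :: t].
Proof.
rewrite pair_bigA /= (reindex (fun p : A * n.-tuple A => [tuple of p.1 :: p.2])) //.
exists (fun w => (thead w, [tuple of behead w])) => [[a t] _|w _] /=.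
  by congr pair; apply/val_inj.
by rewrite -tuple_eta.
Qed.

Lemma qint0 (F : fieldType) : qint F 0 = 0.
Proof. by rewrite qint_sum big_ord0. Qed.

(** The geometric sum 1 + q + q^2 + ... is cut into consecutive blocks of lengths [c a]; the block
    of [a] starts at the total length of the earlier blocks. *)
Lemma qint_sumn (F : fieldType) m (c : 'I_m -> nat) :
  qint F (\sum_a c a) =
  \sum_(a < m) 'X^(\sum_(b < m | (b < a)%N) c b) * qint F (c a).
Proof.
elim: m c => [|m IH] c; first by rewrite !big_ord0 qint0.
rewrite !big_ord_recr /=.
(* This is [a + b] = [a] + q^a [b], checked after multiplication by 1 - q. *)
have -> : qint F (\sum_(i < m) c (widen_ord (leqnSn m) i) + c ord_max) =
    qint F (\sum_(i < m) c (widen_ord (leqnSn m) i)) +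
    'X^(\sum_(i < m) c (widen_ord (leqnSn m) i)) * qint F (c ord_max).
  apply: (mulIf (subr1X_neq0 F)); rewrite mulrDl -mulrA !qintE mulrBr mulr1.
  by rewrite -exprD addrA subrK.
rewrite IH; congr (_ + 'X^_ * _); last first.
  rewrite [RHS]big_mkcond big_ord_recr /= ltnn addn0.
  by apply: eq_bigr => i _; rewrite ltn_ord.
apply: eq_bigr => i _; congr ('X^_ * _).
rewrite [RHS]big_mkcond big_ord_recr /= ltnNge ltnW //= addn0.
by rewrite -big_mkcond.
Qed.

Fixpoint inversions {m} (s : seq 'I_m) : nat :=
  if s is a :: t then (count (fun b : 'I_m => (b < a)%N) t + inversions t)%N else 0%N.

Lemma inversionsE m n (w : n.-tuple 'I_m) :
  inversions w = (\sum_(i < n) \sum_(j < n) (tnth w j < tnth w i) * (i < j))%N.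
Proof.
elim: n w => [|n IH] w; first by rewrite big_ord0 tuple0.
case/tupleP: w => a t /=; rewrite IH big_ord_recl; congr addn.
  rewrite big_ord_recl !muln0 add0n -sum1_count big_mkcond big_tuple /=.
  apply: eq_bigr => j _; rewrite tnth0 tnthS /= muln1.
  by case: ifP.
apply: eq_bigr => i _; rewrite big_ord_recl muln0 add0n.
by apply: eq_bigr => j _; rewrite !tnthS.
Qed.

(** The inversions created by a front letter depend only on the content of the tail, so their power
    of q can be taken out of the sum over tails of fixed content. *)
Lemma count_lt_content m (s : seq 'I_m) (a : 'I_m) :
  count (fun b : 'I_m => (b < a)%N) s =
  (\sum_(b : 'I_m | (b < a)%N) count_mem b s)%N.
Proof.
elim: s => [|x s IH] /=; first by rewrite big1.
rewrite big_split /= -IH; congr addn.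
case: ltnP => xa; last first.
  by rewrite big1 // => b ba; case: (x =P b) => [xb|//]; move: ba; rewrite -xb ltnNge xa.
rewrite (bigD1 x) //= eqxx big1 // => b /andP[_ /negPf].
by rewrite eq_sym => ->.
Qed.

(* The letter [a] in front is followed by [\sum_(b < a) c b] smaller letters, and
   [qint_sumn] adds up the resulting powers of q. *)
Lemma sum_inversions_content (F : fieldType) m n (c : 'I_m -> nat) :
  (\sum_a c a)%N = n ->
  (\sum_(w : n.-tuple 'I_m | [forall a, count_mem a w == c a]) 'X^(inversions w)) *
    \prod_a qfact F (c a) = qfact F n.
Proof.
elim: n c => [|n IH] c cn.
  have c0 a : c a = 0%N.
    by apply/eqP; rewrite -leqn0 -cn (bigD1 a) //= leq_addr.
  rewrite [X in _ * X]big1 ?mulr1; last by move=> a _; rewrite c0 /qfact big_geq.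
  rewrite (bigD1 [tuple]) /=; last by apply/forallP => a; rewrite /= c0.
  rewrite big1 => [|w /andP[_ /eqP]]; last by rewrite (tuple0 w) => /(_ erefl).
  by rewrite addr0 /= expr0 /qfact big_geq.
rewrite big_mkcond big_tuple_cons mulr_suml qfactS.
have -> : qint F n.+1 = qint F (\sum_a c a) by rewrite cn.
rewrite qint_sumn mulr_sumr.
apply: eq_bigr => a _; rewrite -big_mkcond /=.
(* If [a] does not occur in the content, no word begins with [a] and [0] = 0, so both sides
   vanish. *)
case ca : (c a) => [|k].
  rewrite qint0 !mulr0 big_pred0 ?mul0r // => t.
  by apply/negbTE/forallPn; exists a; rewrite /= eqxx ca.
(* The content of the tail once the front letter [a] is removed; since [c a] is positive, the
   subtraction is never truncated. *)
pose c' b := (c b - (a == b))%N.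
have cE b : c b = ((a == b) + c' b)%N.
  by rewrite /c'; case: (a =P b) => [<-|_]; rewrite ?ca //= ?subn1 ?subn0.
have c'n : (\sum_b c' b)%N = n.
  apply: (@addnI 1); rewrite [RHS]add1n -cn (bigD1 a) //= [in RHS](bigD1 a) //=.
  rewrite (cE a) eqxx -addnA; congr (_ + (_ + _))%N; apply: eq_bigr => b ba.
  by rewrite (cE b) eq_sym (negPf ba).
have -> : \prod_b qfact F (c b) = qint F k.+1 * \prod_b qfact F (c' b).
  rewrite (bigD1 a) //= [in RHS](bigD1 a) //= ca qfactS mulrA (mulrC (qint _ _)).
  have -> : c' a = k by rewrite /c' ca eqxx subn1.
  congr (_ * _); apply: eq_bigr => b ba.
  by rewrite (cE b) eq_sym (negPf ba).
rewrite -(IH _ c'n).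
transitivity (('X^(\sum_(b < m | (b < a)%N) c b) * \sum_(t : n.-tuple 'I_m |
    [forall b, count_mem b t == c' b]) 'X^(inversions t)) *
    (qint F k.+1 * \prod_b qfact F (c' b))); last by rewrite mulrACA mulrC.
congr (_ * _); rewrite mulr_sumr.
apply: eq_big => [t|t /forallP h].
  by apply: eq_forallb => b; rewrite /= cE eqn_add2l.
rewrite exprD; congr ('X^_ * _).
rewrite count_lt_content; apply: eq_bigr => b ba.
have := eqP (h b); rewrite /=; case: (a =P b) => [ab|_ //]; by rewrite ab ltnn in ba.
Qed.

(** Words are grouped by content. Each group sums to one q-multinomial coefficient, by
    [sum_inversions_content] and cancellation of the nonzero product of q-factorials. *)
Lemma galois_inversions (F : fieldType) n m :
  galois F n m = \sum_(w : n.-tuple 'I_m) 'X^(inversions w).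
Proof.
have content_lt (w : n.-tuple 'I_m) a : (count_mem a w < n.+1)%N.
  by rewrite ltnS -[leqRHS](size_tuple w) count_size.
pose content (w : n.-tuple 'I_m) := [ffun a => Ordinal (content_lt w a)].
rewrite /galois (partition_big content (fun k => \sum_a k a == n)%N) => [|w _].
  apply: eq_bigr => k /eqP kn.
  have q0 : \prod_a qfact F (k a) != 0.
    by rewrite prodf_seq_neq0; apply/allP => a _; apply: qfact_neq0.
  apply: (mulIf q0); rewrite (qmultinomE F kn) -(sum_inversions_content F _ _ _ kn).
  congr (_ * _); apply: eq_bigl => w; apply/forallP/eqP => [h|<- a].
    by apply/ffunP => a; apply/val_inj; rewrite ffunE; apply/eqP/h.
  by rewrite ffunE.
rewrite -[X in _ == X](size_tuple w) -sum1_size.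
under eq_bigr do rewrite ffunE /= -sum1_count big_mkcond.
rewrite exchange_big /=; apply/eqP/eq_bigr => a _.
rewrite (bigD1 a) //= eqxx big1 // => b /negPf.
by rewrite eq_sym => ->.
Qed.

(* Sorting the positions by the injective keys [k] turns the inversions of [x]
   relative to [k] into the inversions of the permuted word. *)
Lemma card_inversions_keys m n (k : 'I_n -> nat) (s : nat) : injective k ->
  #|[set x : n.-tuple 'I_m |
      (\sum_i \sum_j (tnth x j < tnth x i) * (k i < k j))%N == s]%SET| =
  #|[set x : n.-tuple 'I_m | inversions x == s]%SET|.
Proof.
move=> kinj.
(* The rank of a position is the number of smaller keys. Ranks are ordered like the keys, and by
   injectivity they form a permutation of the positions. *)
have rk_lt i : (#|[set j | (k j < k i)%N]%SET| < n)%N.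
  rewrite -[X in (_ < X)%N]card_ord -cardsT; apply: proper_card.
  by rewrite properE finset.subsetT /=; apply/fintype.subsetPn; exists i; rewrite ?inE ?ltnn.
pose rk i := Ordinal (rk_lt i).
have rkE i j : (rk i < rk j)%N = (k i < k j)%N.
  have mono a b : (k a < k b)%N -> (rk a < rk b)%N.
    move=> ab; apply: proper_card; rewrite properE; apply/andP; split.
      by apply/fintype.subsetP => c; rewrite !inE => /ltn_trans; apply.
    by apply/fintype.subsetPn; exists a; rewrite !inE ?ltnn.
  apply/idP/idP; last exact: mono.
  case: (ltngtP (k i) (k j)) => // [/mono/ltnW|/kinj ->]; last by rewrite ltnn.
  by rewrite leqNgt => /negbTE ->.
have rkinj : injective rk.
  move=> i j ij; apply: kinj.
  by case: (ltngtP (k i) (k j)) => //; rewrite -rkE ij ltnn.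
pose sg := perm rkinj.
pose f (x : n.-tuple 'I_m) := [tuple tnth x (sg i) | i < n].
have finj : injective f.
  move=> x y /(congr1 (fun t => tnth t)) xy; apply: eq_from_tnth => i.
  have := congr1 (fun h => h ((sg^-1)%g i)) xy.
  by rewrite !tnth_mktuple permKV.
rewrite -[LHS](card_preimset _ finj); apply: eq_card => x; rewrite !inE inversionsE.
congr (_ == s); rewrite [in RHS](reindex_inj (@perm_inj _ sg)) /=.
apply: eq_bigr => i _; rewrite [in RHS](reindex_inj (@perm_inj _ sg)) /=.
apply: eq_bigr => j _.
by rewrite !tnth_mktuple -(rkE i j) !permE.
Qed.

(** * Recovering a law from a polynomial generating function *)

Lemma horner_bound (R : realFieldType) (p : {poly R}) (q : R) : 0 <= q <= 1 ->
  `|p.[q]| <= \sum_(i < size p) `|p`_i|.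
Proof.
move=> /andP[q0 q1]; rewrite horner_coef; apply: le_trans (ler_norm_sum _ _ _) _.
apply: ler_sum => i _; rewrite normrM normrX (ger0_norm q0).
by rewrite ler_piMr // exprn_ile1.
Qed.

(** A nonzero constant coefficient would violate the bound for small q; once it is zero, dividing by
    q lowers both the degree and [K] by one. *)
Lemma coef_eq0_near0 (R : realFieldType) K (p : {poly R}) :
  (forall q, 0 < q <= 1 -> `|p.[q]| <= q ^+ K) ->
  forall j, (j < K)%N -> p`_j = 0.
Proof.
elim: K p => [//|K IH] p; elim/poly_ind: p => [_ j _|p c _ pq]; first exact: coef0.
have hE q : (p * 'X + c%:P).[q] = p.[q] * q + c by rewrite !hornerE.
have c0 : c = 0.
  apply/eqP/negPn/negP => cn0.
  set M := \sum_(i < size p) `|p`_i|.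
  have M0 : 0 <= M by apply: sumr_ge0.
  have cp : 0 < `|c| by rewrite normr_gt0.
  (* Chosen so that q <= 1 and q (1 + M) < |c|, whereas the hypothesis would give |c| <= q^(K+1) + q
     M <= q (1 + M). *)
  pose q := `|c| / (`|c| + (1 + M)).
  have dp : 0 < `|c| + (1 + M) by lra.
  have q0 : 0 < q by rewrite divr_gt0.
  have q1 : q <= 1 by rewrite ler_pdivrMr //; lra.
  have qM : q * (1 + M) < `|c|.
    rewrite /q mulrAC ltr_pdivrMr // ltr_pM2l //; lra.
  have /pq : 0 < q <= 1 by rewrite q0.
  rewrite hE => h.
  have hq : q ^+ K.+1 <= q by rewrite exprS ler_piMr ?exprn_ile1 // ltW.
  have pM : `|p.[q]| * q <= M * q.
    by rewrite ler_wpM2r ?horner_bound ?q1 ?andbT // ltW.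
  have : `|c| <= `|p.[q] * q + c| + `|p.[q] * q|.
    by rewrite -[X in `|X| <= _](addKr (p.[q] * q)) addrC ler_normB.
  rewrite normrM (ger0_norm (ltW q0)); lra.
move=> [|j] jK; rewrite coefD coefMX coefC /= ?c0 ?addr0 //.
apply: IH jK => q q01; have /andP[q0 _] := q01.
have := pq q q01; rewrite hE c0 addr0 normrM (ger0_norm (ltW q0)).
by rewrite exprSr ler_pM2r.
Qed.

Section PgfDeterminesLaw.
Context {R : realType} {d : measure_display} {T : measurableType d}
  (P : probability T R).

Lemma measurable_preimage1 (Z : {RV P >-> nat}) (j : nat) :
  measurable (Z @^-1` [set j]).
Proof. by rewrite -[X in measurable X]setTI; exact: measurable_funPT. Qed.

Lemma integrable_scale_indic (Z : {RV P >-> nat}) (c : R) j :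
  P.-integrable setT (fun w => (c%:E * (\1_(Z @^-1` [set j]) w)%:E)%E).
Proof.
by apply: integrableZl => //; exact/integrable_indic/measurable_preimage1.
Qed.

Lemma Lfun_indic_sum (Z : {RV P >-> nat}) (c : nat -> R) K :
  (fun w => \sum_(j < K) c j * \1_(Z @^-1` [set val j]) w) \in Lfun P 1.
Proof.
apply/Lfun1_integrable; rewrite /comp; under eq_fun do rewrite -sumEFin.
apply: integrable_sum => // j _; under eq_fun do rewrite EFinM.
exact: integrable_scale_indic.
Qed.

Lemma expectation_indic_sum (Z : {RV P >-> nat}) (c : nat -> R) K :
  'E_P[(fun w => \sum_(j < K) c j * \1_(Z @^-1` [set val j]) w)%R]%E =
  (\sum_(j < K) c j * fine (P (Z @^-1` [set val j])))%:E.
Proof.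
rewrite unlock; under eq_integral do rewrite -sumEFin.
under eq_integral do under eq_bigr do rewrite EFinM.
rewrite integral_sum //= => [|j]; last exact: integrable_scale_indic.
rewrite -sumEFin; apply: eq_bigr => j _.
rewrite integralZl //; last exact/integrable_indic/measurable_preimage1.
rewrite integral_indic //; last exact: measurable_preimage1.
rewrite setIT EFinM fineK // fin_num_measure //; exact: measurable_preimage1.
Qed.

Lemma indic_sum_preimage1 (Z : T -> nat) (c : nat -> R) K w :
  \sum_(j < K) c j * \1_(Z @^-1` [set val j]) w =
  if (Z w < K)%N then c (Z w) else 0.
Proof.
have indE (j : 'I_K) : \1_(Z @^-1` [set val j]) w = (Z w == j)%:R :> R.
  by rewrite indicE; congr (nat_of_bool _)%:R; apply/idP/eqP; rewrite inE.
under eq_bigr do rewrite indE.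
case: ltnP => ZK.
  rewrite (bigD1 (Ordinal ZK)) //= eqxx mulr1 big1 ?addr0 // => j.
  rewrite -val_eqE eq_sym /= => /negPf ->; exact: mulr0.
rewrite big1 // => j _; case: eqP => [Zj|_]; last exact: mulr0.
by move: (ltn_ord j); rewrite -Zj ltnNge ZK.
Qed.

(** For 0 < q <= 1, dropping the values of [Z] above [k] changes the expectation of q^Z by at most
    q^(k+1). Hence [p] and the polynomial of the first k+1 point masses agree up to degree [k]. *)
Lemma pgf_coef (Z : {RV P >-> nat}) (p : {poly R}) : has_pgf Z p ->
  forall k, P (Z @^-1` [set k]) = (p`_k)%:E.
Proof.
move=> Zp k; pose a j := fine (P (Z @^-1` [set j])).
suff -> : p`_k = a k.
  rewrite fineK // fin_num_measure //; exact: measurable_preimage1.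
have mZ (g : nat -> R) : measurable_fun setT (fun w => g (Z w)).
  by apply: (@measurableT_comp _ _ _ _ _ _ g).
pose r := p - \poly_(j < k.+1) a j.
have rk : r`_k = 0.
  apply: (@coef_eq0_near0 _ k.+1) => // q /andP[/ltW q0 q1].
  have pE := Zp q; rewrite ger0_norm // in pE; move/(_ q1): pE => pE.
  (* Pointwise, [lo] <= q^Z <= [lo] + q^(k+1); taking expectations bounds the value of [r] at q. *)
  pose lo w := \sum_(j < k.+1) q ^+ j * \1_(Z @^-1` [set val j]) w.
  have loE w : lo w = if (Z w < k.+1)%N then q ^+ Z w else 0.
    exact: (@indic_sum_preimage1 _ (fun j => q ^+ j)).
  have Elo : 'E_P[lo]%E = ((\poly_(j < k.+1) a j).[q])%:E.
    rewrite /lo (expectation_indic_sum _ (fun j => q ^+ j)); congr EFin.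
    by rewrite horner_poly; apply: eq_bigr => j _; rewrite mulrC.
  have mlo : measurable_fun setT lo.
    rewrite (_ : lo = fun w => if (Z w < k.+1)%N then q ^+ Z w else 0).
      exact: (mZ (fun z => if (z < k.+1)%N then q ^+ z else 0)).
    exact/funext.
  have lo0 w : 0 <= lo w by rewrite loE; case: ifP => _ //; apply: exprn_ge0.
  have mq : measurable_fun setT (fun w => q ^+ Z w).
    exact: (mZ (fun z => q ^+ z)).
  have : ('E_P[lo] <= 'E_P[fun w => (q ^+ Z w)%R])%E.
    apply: expectation_le => //; first by move=> w; apply: exprn_ge0.
    by apply: aeW => w; rewrite loE; case: ifP => _ //; apply: exprn_ge0.
  have : ('E_P[fun w => (q ^+ Z w)%R] <= 'E_P[lo \+ cst (q ^+ k.+1)%R])%E.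
    apply: expectation_le => //.
    - exact: measurable_funD.
    - by move=> w; apply: exprn_ge0.
    - by move=> w; rewrite addr_ge0 // exprn_ge0.
    apply: aeW => w; rewrite /= loE; case: ltnP => kZ.
      by rewrite lerDl exprn_ge0.
    by rewrite add0r ler_wiXn2l.
  rewrite expectationD; last 2 first.
  - exact: (Lfun_indic_sum _ (fun j => q ^+ j)).
  - exact: Lfun_cst.
  rewrite expectation_cst Elo pE -EFinD !lee_fin /r hornerD hornerN => h1 h2.
  by rewrite ger0_norm ?subr_ge0 // lerBlDl.
move: rk; rewrite /r coefB coef_poly ltnSn => /eqP; rewrite subr_eq0.
by move/eqP.
Qed.

Lemma nat_law_ext d' (T' : measurableType d') (P' : probability T' R)
    (Z : {RV P >-> nat}) (Z' : {RV P' >-> nat}) :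
  (forall k, P (Z @^-1` [set k]) = P' (Z' @^-1` [set k])) ->
  forall A, distribution P Z A = distribution P' Z' A.
Proof.
move=> ZZ' A.
have AE : A = \bigcup_(k in A) [set k].
  by apply/seteqP; split => [k Ak|k [j Aj ->]] //; exists k.
have tA : trivIset A (fun k : nat => [set k]).
  by apply/trivIsetP => i j _ _ /eqP ij; apply/seteqP; split => // k [-> ].
rewrite AE !measure_bigcup //.
by apply: eq_eseriesr => k _; apply: ZZ'.
Qed.

End PgfDeterminesLaw.

(** * Grid cells and the probability of a grid atom *)

Lemma sum_measure_le {R : realType} {d : measure_display}
    {T : measurableType d} (P : probability T R) (I : finType) (D : pred I)
    (F : I -> set T) (B : set T) :
  (forall i, measurable (F i)) -> measurable B ->
  (forall i j w, F i w -> F j w -> i = j) -> (forall i, D i -> F i `<=` B) ->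
  (\sum_(i | D i) P (F i) <= P B)%E.
Proof.
move=> mF mB dF FB; rewrite -big_enum fsbig_seq ?enum_uniq //.
have tF : trivIset [set` enum D] F.
  by move=> i j _ _ [w [Fi Fj]]; exact: dF Fi Fj.
rewrite -measure_fin_bigcup //=; apply: le_measure.
- by rewrite inE; apply: fin_bigcup_measurable.
- by rewrite inE.
by apply: bigcup_sub => i; rewrite /= mem_enum; exact: FB.
Qed.

(** Half-open, so that cells of different index are disjoint. *)
Definition grid_cell {R : realType} (N k : nat) : set R :=
  `[k%:R / N%:R, k.+1%:R / N%:R[.

Lemma measurable_grid_cell {R : realType} N k :
  measurable (@grid_cell R N k).
Proof. exact: measurable_itv. Qed.

Lemma uniform_prob_grid_cell {R : realType} N k : (k < N)%N ->
  uniform_prob (@ltr01 R) (grid_cell N k) = (N%:R^-1)%:E.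
Proof.
move=> kN; have N0 : 0 < N%:R :> R by rewrite ltr0n (leq_trans _ kN).
rewrite /uniform_prob (eq_integral (cst 1%E)) => [|x].
  rewrite integral_cst; last exact: measurable_grid_cell.
  rewrite mul1e /grid_cell /= lebesgue_measure_itv /= lte_fin.
  rewrite ltr_pM2r ?invr_gt0 // ltr_nat ltnSn -EFinB -mulrBl.
  by rewrite -natrB // subSnn mul1r.
rewrite inE /grid_cell /= in_itv /= => /andP[kx xk].
rewrite /uniform_pdf subr0 invr1 (le_trans _ kx) ?divr_ge0 //=.
rewrite ifT //; apply: le_trans (ltW xk) _.
by rewrite ler_pdivrMr // mul1r ler_nat.
Qed.

(** Used twice: with y = y' it shows that a point lies in only one cell, and otherwise it compares
    the [Y i] through their cell indices. *)
Lemma grid_cell_mono {R : realType} N k k' (y y' : R) : (0 < N)%N ->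
  grid_cell N k y -> grid_cell N k' y' -> y <= y' -> (k <= k')%N.
Proof.
rewrite /grid_cell /= !in_itv /= => N0 /andP[ky _] /andP[_ yk'] yy'.
have := le_lt_trans (le_trans ky yy') yk'.
by rewrite ltr_pM2r ?invr_gt0 ?ltr0n // ltr_nat ltnS.
Qed.

Section GridAtoms.
Context {R : realType} {d : measure_display} {T : measurableType d}
  {P : probability T R} (X : nat -> {RV P >-> nat}) (Y : nat -> {RV P >-> R}).
Hypothesis indXY : independent_sequences X Y.

Lemma independent_atom n (a : 'I_n -> nat) (B : 'I_n -> set R) :
  (forall i, measurable (B i)) ->
  P [set w | forall i : 'I_n, X i w = a i /\ B i (Y i w)] =
  (\prod_(i < n) P (X i @^-1` [set a i]) *
   \prod_(i < n) P (Y i @^-1` B i))%E.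
Proof.
move=> mB.
(* Independence asks for events indexed by all of [nat + nat]; indices from [n] on receive the sure
   event. *)
pose A (i : nat + nat) : set T := match i with
  | inl j => X j @^-1` oapp (fun o : 'I_n => [set a o]) setT (insub j)
  | inr j => Y j @^-1` oapp B setT (insub j) end.
pose s : seq (nat + nat) :=
  [seq inl (val i) | i <- enum 'I_n] ++ [seq inr (val i) | i <- enum 'I_n].
have us : uniq s.
  have inl_val_inj : injective (fun i : 'I_n => inl (val i) : nat + nat).
    by move=> i j [ij]; exact: val_inj.
  have inr_val_inj : injective (fun i : 'I_n => inr (val i) : nat + nat).
    by move=> i j [ij]; exact: val_inj.
  rewrite cat_uniq (map_inj_uniq inl_val_inj) (map_inj_uniq inr_val_inj).
  rewrite enum_uniq.
  rewrite andbT; apply/hasPn => _ /mapP[i _ ->].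
  by apply/negP => /mapP[].
have sP (i : 'I_n) : (inl (val i) \in s) && (inr (val i) \in s).
  by rewrite !mem_cat !(map_f _ (mem_enum _ i)) orbT.
(* A finite set listing exactly [s], up to order, so that the product over [J] splits into its [X]
   half and its [Y] half. *)
have [J JE Js] : exists2 J : {fset (nat + nat)%type}, J =i s & perm_eq J s.
  exists (seq_fset tt s); first exact: seq_fsetE.
  by rewrite -[X in perm_eq _ X](undup_id us) seq_fset_perm.
have EA i : i \in J ->
    (match i with inl i => events_of (X i) | inr j => events_of (Y j) end) (A i).
  case: i => i _.
    by eexists; last by rewrite setTI.
  eexists; last by rewrite setTI.
  by case: insub => //=.
have -> : [set w | forall i : 'I_n, X i w = a i /\ B i (Y i w)] =
    \bigcap_(i in [set` J]) A i.
  apply/seteqP; split => [w h i|w h i].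
    rewrite /= JE mem_cat => /orP[] /mapP[j _ ->]; rewrite /A valK /=;
    by have [] := h j.
  have /andP[il ir] := sP i; split.
    by have := h (inl (val i)); rewrite /= JE valK /= => /(_ il).
  by have := h (inr (val i)); rewrite /= JE valK /= => /(_ ir).
rewrite (indXY _ _ EA) (perm_big _ Js) big_cat /=.
rewrite !big_map -!enumT !big_enum /=.
by congr (_ * _)%E; apply: eq_bigr => i _; rewrite valK.
Qed.

(** Letters of [x] are numbered from 0 and the values of [X i] from 1, hence the successor. *)
Lemma prob_grid_atom m n N (x : n.-tuple 'I_m) (k : 'I_n -> 'I_N) :
  (forall i, uniform_on_1_to m (X i)) -> (forall i, uniform_on_01 (Y i)) ->
  P [set w | forall i : 'I_n,
      X i w = (tnth x i).+1 /\ grid_cell N (k i) (Y i w)] =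
  (m%:R ^- n * N%:R ^- n)%:E.
Proof.
move=> unifX unifY.
rewrite (independent_atom n (fun i => (tnth x i).+1)
  (fun i => grid_cell N (k i)) (fun i => measurable_grid_cell N (k i))).
rewrite (eq_bigr (fun=> (m%:R^-1)%:E)) => [|i _]; last first.
  by apply: etrans (unifX i (tnth x i).+1) _; rewrite /= ltn_ord.
rewrite [X in (_ * X)%E](eq_bigr (fun=> (N%:R^-1)%:E)) => [|i _]; last first.
  apply: etrans (unifY i _ (measurable_grid_cell N (k i))) _.
  exact: uniform_prob_grid_cell.
by rewrite !prodEFin !prodr_const card_ord -EFinM !exprVn.
Qed.

End GridAtoms.

(** * Falling factorials compared with powers *)

Lemma leq_ffact_expn N n : (N ^_ n <= N ^ n)%N.
Proof.
by elim: n => // n IH; rewrite ffactnSr expnSr leq_mul // leq_subr.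
Qed.

(** For N > 0 this is the estimate N^_n / N^n >= 1 - n^2 / N, cleared of denominators and
    subtractions. *)
Lemma ffact_near_expn N n : (N ^ n.+1 <= N ^_ n * N + n ^ 2 * N ^ n)%N.
Proof.
elim: n => [|n IH]; first by rewrite ffactn0 expn1 mul1n leq_addr.
rewrite ffactnSr [(N ^ n.+2)%N]expnSr.
apply: leq_trans (leq_mul IH (leqnn N)) _.
have h : (N ^_ n * N <= N ^_ n * (N - n) + N ^ n * n)%N.
  apply: (@leq_trans (N ^_ n * ((N - n) + n))).
    by rewrite leq_mul //; lia.
  by rewrite mulnDr leq_add2l leq_mul // leq_ffact_expn.
have := leq_mul h (leqnn N); rewrite [(N ^ n.+1)%N]expnSr.
move: (N ^_ n) (N ^ n)%N (N - n)%N => a e c.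
have -> : ((n.+1 ^ 2) * (e * N) = n ^ 2 * e * N + e * n * N + (n.+1) * (e * N))%N.
  by rewrite -!mulnn; nia.
by rewrite !mulnDl; lia.
Qed.

Lemma ler_of_ffact_bound {R : realType} n (a b : R) : 0 <= a ->
  (forall N, (0 < N)%N -> (N ^_ n)%:R * a <= b * N%:R ^+ n) -> a <= b.
Proof.
move=> a0 h; rewrite leNgt; apply/negP => ba.
(* If b < a, the Archimedean property gives N with n^2 a < (a - b) N, which contradicts the
   hypothesis at N combined with [ffact_near_expn]. *)
pose N := (Num.bound (n%:R ^+ 2 * a / (a - b))).+1.
have ab : 0 < a - b by rewrite subr_gt0.
have hN : n%:R ^+ 2 * a < (a - b) * N%:R.
  have q0 : 0 <= n%:R ^+ 2 * a / (a - b).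
    by rewrite divr_ge0 ?mulr_ge0 ?exprn_ge0 // ltW.
  rewrite -ltr_pdivrMl // mulrC; apply: lt_le_trans (archi_boundP q0) _.
  by rewrite ler_nat.
have N0 : 0 < N%:R :> R by rewrite ltr0n.
have : (N ^ n.+1)%:R * a <= (N ^_ n * N + n ^ 2 * N ^ n)%:R * a.
  by rewrite ler_wpM2r // ler_nat ffact_near_expn.
rewrite natrD !natrM !natrX mulrDl => h1.
have h2 := ler_wpM2r (ltW N0) (h N isT).
have Nn : 0 < N%:R ^+ n :> R by rewrite exprn_gt0.
have h3 : (n%:R ^+ 2 * a) * N%:R ^+ n < (a - b) * N%:R * N%:R ^+ n.
  by rewrite ltr_pM2r.
rewrite exprSr in h1; nra.
Qed.

(** * The law of [U] *)

Section InversionLaw.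
Context {R : realType} {d : measure_display} {T : measurableType d}
  {P : probability T R} (X : nat -> {RV P >-> nat}) (Y : nat -> {RV P >-> R}).

Lemma U_on_grid_atom m n N (x : n.-tuple 'I_m) (k : 'I_n -> 'I_N) w :
  injective k ->
  (forall i : 'I_n, X i w = (tnth x i).+1 /\ grid_cell N (k i) (Y i w)) ->
  U P n X Y w = (\sum_i \sum_j (tnth x j < tnth x i) * (k i < k j))%N.
Proof.
move=> kinj h; apply: eq_bigr => i _; apply: eq_bigr => j _.
have [-> ci] := h i; have [-> cj] := h j.
rewrite ltnS; congr (_ * nat_of_bool _)%N.
have N0 : (0 < N)%N by apply: leq_ltn_trans (ltn_ord (k i)).
case: (ltnP (k i) (k j)) => kk; case: (ltP (Y i w) (Y j w)) => // yy.
  by have := grid_cell_mono _ _ _ _ _ N0 cj ci yy; rewrite leqNgt kk.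
have kk' := grid_cell_mono _ _ _ _ _ N0 ci cj (ltW yy).
(* The remaining case has equal cell indices; injectivity of [k] then forces i = j, and Y_i < Y_i is
   absurd. *)
have ij : i = j by apply/kinj/val_inj/eqP; rewrite eqn_leq kk kk'.
by rewrite ij ltxx in yy.
Qed.

Hypothesis indXY : independent_sequences X Y.

(** The atoms with injective [k] on which [U] equals [s] are disjoint and equally likely. There are
    N^_n choices of [k], and by [card_inversions_keys] each admits as many words as there are words
    with [s] inversions. *)
Lemma prob_U_ge m n N s :
  (forall i, uniform_on_1_to m (X i)) -> (forall i, uniform_on_01 (Y i)) ->
  (((N ^_ n * #|[set x : n.-tuple 'I_m | inversions x == s]%SET|)%:R *
    (m%:R ^- n * N%:R ^- n))%:E <= P (U P n X Y @^-1` [set s]))%E.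
Proof.
move=> unifX unifY.
pose F (p : {ffun 'I_n -> 'I_N} * n.-tuple 'I_m) := [set w |
  forall i : 'I_n, X i w = (tnth p.2 i).+1 /\ grid_cell N (p.1 i) (Y i w)].
pose u (p : {ffun 'I_n -> 'I_N} * n.-tuple 'I_m) :=
  (\sum_i \sum_j (tnth p.2 j < tnth p.2 i) * (p.1 i < p.1 j))%N.
have mF p : measurable (F p).
  have -> : F p = \bigcap_(i in [set: 'I_n])
     (X i @^-1` [set (tnth p.2 i).+1] `&` Y i @^-1` grid_cell N (p.1 i)).
    by apply/seteqP; split => w h i; [move=> _; exact: h | exact: h].
  apply: fin_bigcap_measurable => // i _; apply: measurableI.
    exact: measurable_preimage1.
  rewrite -[X in measurable X]setTI; apply: measurable_funPT => //.
  exact: measurable_grid_cell.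
have dF p p' w : F p w -> F p' w -> p = p'.
  case: p p' => [k x] [k' x'] /= h h'; congr pair.
    apply/ffunP => i; apply/val_inj/eqP; rewrite eqn_leq.
    have [_ c] := h i; have [_ c'] := h' i.
    have N0 : (0 < N)%N by apply: leq_ltn_trans (ltn_ord (k i)).
    by rewrite (grid_cell_mono _ _ _ _ _ N0 c c') // (grid_cell_mono _ _ _ _ _ N0 c' c).
  apply: eq_from_tnth => i; apply/val_inj.
  by have [e _] := h i; have [e' _] := h' i; move: e'; rewrite e => -[].
pose D (p : {ffun 'I_n -> 'I_N} * n.-tuple 'I_m) :=
  injectiveb p.1 && (u p == s).
have FU p : D p -> F p `<=` U P n X Y @^-1` [set s].
  move=> /andP[/injectiveP pinj /eqP us] w /=.
  by move/(U_on_grid_atom _ _ _ _ _ _ pinj) ->.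
have := sum_measure_le P _ D F (U P n X Y @^-1` [set s]) mF
  (measurable_preimage1 P _ s) dF FU.
apply: le_trans; rewrite (eq_bigr (fun=> (m%:R ^- n * N%:R ^- n)%:E)); last first.
  by move=> p _; exact: (prob_grid_atom X Y indXY).
rewrite sumEFin sumr_const mulr_natl lee_fin le_eqVlt; apply/orP; left.
apply/eqP; congr (_ *+ _).
transitivity (\sum_(k : {ffun 'I_n -> 'I_N} | injectiveb k)
    \sum_(x : n.-tuple 'I_m | u (k, x) == s) 1)%N; last first.
  by rewrite pair_big_dep -sum1_card; apply: eq_bigl => -[].
rewrite (eq_bigr (fun=> #|[set x : n.-tuple 'I_m | inversions x == s]%SET|)).
  rewrite sum_nat_cond_const; congr (_ * _)%N.
  rewrite -[X in (X ^_ _)%N](card_ord N) -[X in (_ ^_ X)%N](card_ord n).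
  by rewrite -card_inj_ffuns; apply: eq_card => k; rewrite !inE.
move=> k /injectiveP kinj.
rewrite -(card_inversions_keys m n (fun i => k i)); last first.
  by move=> i j /val_inj /kinj.
by rewrite -sum1_card; apply: eq_bigl => x; rewrite inE.
Qed.

Lemma pgf_U m n :
  (0 < m)%N ->
  (forall i, uniform_on_1_to m (X i)) -> (forall i, uniform_on_01 (Y i)) ->
  has_pgf (P := P) (U P n X Y) (m%:R ^- n *: galois R n m).
Proof.
move=> m0 unifX unifY; set p := _ *: _.
(* There are n^2 pairs of positions, so [K] strictly bounds both [U] and [inversions], and all sums
   over values are finite. *)
pose K := (n * n).+1.
have bK (b : 'I_n -> 'I_n -> bool) : (\sum_i \sum_j b i j < K)%N.
  rewrite ltnS -[X in (_ <= X * X)%N]card_ord -sum_nat_const.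
  apply: leq_sum => i _; rewrite -sum1_card; apply: leq_sum => j _.
  exact: leq_b1.
have UK w : (U P n X Y w < K)%N.
  rewrite /U; under eq_bigr do under eq_bigr do rewrite mulnb.
  exact: bK.
have wK (x : n.-tuple 'I_m) : (inversions x < K)%N.
  rewrite inversionsE; under eq_bigr do under eq_bigr do rewrite mulnb.
  exact: bK.
have pcoef s : p`_s = m%:R ^- n * #|[set x : n.-tuple 'I_m | inversions x == s]%SET|%:R.
  rewrite /p galois_inversions coefZ coef_sum -sum1_card natr_sum [in RHS]big_mkcond /=.
  congr (_ * _); apply: eq_bigr => x _; rewrite coefXn inE eq_sym.
  by case: eqP.
have psize : (size p <= K)%N.
  apply/leq_sizeP => s Ks; rewrite pcoef.
  rewrite (_ : [set x | _]%SET = finset.set0) ?cards0 ?mulr0 //.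
  apply/setP => x; rewrite !inE; apply/negbTE; rewrite neq_ltn.
  by rewrite (leq_trans (wK x) Ks).
have p1 : p.[1] = 1.
  rewrite /p galois_inversions hornerZ horner_sum.
  under eq_bigr do rewrite hornerXn expr1n.
  rewrite sumr_const card_tuple card_ord natrX mulVf //.
  by rewrite expf_neq0 // pnatr_eq0 -lt0n.
pose a s := fine (P (U P n X Y @^-1` [set s])).
have EU (c : nat -> R) :
    'E_P[(fun w => c (U P n X Y w))%R]%E = (\sum_(s < K) c s * a s)%:E.
  rewrite -expectation_indic_sum; congr expectation; apply/funext => w.
  by rewrite indic_sum_preimage1 UK.
(* The lower bound of [prob_U_ge] holds for every mesh 1/N; letting N grow removes the factor N^_n /
   N^n. *)
have a_ge s : p`_s <= a s.
  rewrite pcoef; apply: (@ler_of_ffact_bound R n).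
    by rewrite mulr_ge0 ?invr_ge0 ?exprn_ge0.
  move=> N N0; have Nn : 0 < N%:R ^+ n :> R by rewrite exprn_gt0 ?ltr0n.
  rewrite -ler_pdivrMr // -lee_fin /a fineK; last first.
    by rewrite fin_num_measure //; exact: (measurable_preimage1 P _ s).
  apply: le_trans (prob_U_ge m n N s unifX unifY).
  by rewrite lee_fin natrM -!mulrA [X in _ <= _ * X]mulrCA.
(* Both families have total mass 1: the expectation of the constant 1 on one side, [p1] on the
   other. With [a_ge], every difference is then zero. *)
have a_sum : \sum_(s < K) (a s - p`_s) = 0.
  rewrite sumrB; have := EU (fun=> 1); rewrite expectation_cst => -[].
  under eq_bigr do rewrite mul1r.
  move=> <-; have := p1; rewrite (horner_coef_wide 1 psize).
  under eq_bigr do rewrite expr1n mulr1.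
  by move=> ->; rewrite subrr.
have aE (s : 'I_K) : a s = p`_s.
  apply/eqP; rewrite -subr_eq0; apply/eqP.
  by apply: (psumr_eq0P _ a_sum) => // i _; rewrite subr_ge0.
move=> q _; rewrite (EU (fun s => q ^+ s)) (horner_coef_wide q psize).
by congr EFin; apply: eq_bigr => s _; rewrite aE mulrC.
Qed.

End InversionLaw.

Theorem theorem3p1 (R : realType) (d : measure_display) (T : measurableType d)
    (P : probability T R) (m n : nat) (hm : (2 <= m)%N) (hn : (1 <= n)%N)
    (X : nat -> {RV P >-> nat}) (Y : nat -> {RV P >-> R})
    (indXY : independent_sequences X Y)
    (unifX : forall i : nat, uniform_on_1_to m (X i))
    (unifY : forall i : nat, uniform_on_01 (Y i)) :
  has_pgf (P := P) (U P n X Y) (m%:R ^- n *: galois R n m) /\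
  (forall (d' : measure_display) (T' : measurableType d')
      (P' : probability T' R) (G : {RV P' >-> nat}),
    has_pgf G (m%:R ^- n *: galois R n m) ->
    forall A : set nat,
      distribution P (U P n X Y) A = distribution P' G A).
Proof.
have pgfU := pgf_U X Y indXY m n (ltnW hm) unifX unifY.
split=> // d' T' P' G pgfG; apply: nat_law_ext => k.
by rewrite (pgf_coef _ _ _ pgfU) (pgf_coef _ _ _ pgfG).
Qed.
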